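(* Let $N=(ST,suc,\{nei_a\}_{a\in AG},L)$ be a single-coalition-first neighborhood model with neighborhood functions $\{nei_C\}_{C\subseteq AG}$. The following two conditions are equivalent: (1) for all $a\in AG$ and $s\in ST$, $nei_{\{a\}}(s)$ is a partition of $suc(s)$; (2) for all $C\subseteq AG$ and $s\in ST$, $nei_C(s)$ is a partition of $suc(s)$.
   Context: $AG$ is a finite nonempty set of agents, $AP$ a countable set of atomic propositions. A single-coalition-first neighborhood model is $N=(ST,suc,\{nei_a\}_{a\in AG},L)$ with $ST$ nonempty, $suc:ST\to\mathcal P(ST)$, $L:ST\to\mathcal P(AP)$, and for all $a,s$, $nei_a(s)\subseteq\mathcal P(ST)$ a cover of $suc(s)$ (its union is $suc(s)$ and $\emptyset\notin nei_a(s)$). For families of nonempty sets, $\Delta_1\odot\Delta_2=\{Y_1\cap Y_2\mid Y_1\in\Delta_1,Y_2\in\Delta_2,Y_1\cap Y_2\neq\emptyset\}$, extended to finitely many families ($\bigodot\{\Delta\}=\Delta$). The neighborhood functions are $nei_C(s)=\emptyset$ if $suc(s)=\emptyset$; $\{suc(s)\}$ if $suc(s)\neq\emptyset$ and $C=\emptyset$; $\bigodot\{nei_a(s)\mid a\in C\}$ otherwise (so $nei_{\{a\}}=nei_a$ when $suc(s)\ne\emptyset$). A partition of a set $Z$ is a family of nonempty subsets of $Z$ whose union is $Z$ and whose distinct members are disjoint. *)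

(* Defs.v *)
From HB Require Import structures.
From mathcomp Require Import all_boot.
From mathcomp Require Import boolp classical_sets.
Set Implicit Arguments.
Unset Strict Implicit.
Unset Printing Implicit Defensive.
Local Open Scope classical_set_scope.

Definition odot (T : Type) (D1 D2 : set (set T)) : set (set T) :=
  [set Y | exists Y1 Y2, [/\ D1 Y1, D2 Y2, Y = Y1 `&` Y2 & Y !=set0]].

Lemma odotC (T : Type) : commutative (@odot T).
Proof.
suff H D1 D2 : @odot T D1 D2 `<=` odot D2 D1.
  by move=> D1 D2; apply/seteqP; split; apply: H.
by move=> Y [Y1 [Y2 [? ? -> ?]]]; exists Y2, Y1; split=> //; rewrite setIC.
Qed.

Lemma odotA (T : Type) : associative (@odot T).
Proof.
suff H D1 D2 D3 : @odot T D1 (odot D2 D3) `<=` odot (odot D1 D2) D3.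
  move=> D1 D2 D3; apply/seteqP; split; first exact: H.
  by rewrite [X in _ `<=` X]odotC (odotC D2) (odotC _ D3) (odotC D1); exact: H.
move=> Y [Y1 [_ [? [Y2 [Y3 [? ? -> _]]] -> ne]]].
exists (Y1 `&` Y2), Y3; split=> //; last by rewrite -setIA.
by exists Y1, Y2; split=> //; case: ne => x [? []]; exists x.
Qed.

HB.instance Definition _ (T : Type) :=
  SemiGroup.isComLaw.Build (set (set T)) (@odot T) (@odotA T) (@odotC T).

Lemma odotT (T : Type) (D : set (set T)) : ~ D set0 -> odot D [set setT] = D.
Proof.
move=> D0; apply/seteqP; split=> [_ [Y [_ [DY -> -> _]]]|Y DY].
  by rewrite setIT.
exists Y, setT; split=> //; first by rewrite setIT.
by apply/set0P/eqP => Y0; apply: D0; rewrite -Y0.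
Qed.

(* The families are indexed by the members of C, so equal families given by
   distinct indices are counted separately.  The default value [set setT] is
   neutral for odot on families of nonempty sets (odotT), so it does not
   contribute when C is nonempty; see bigodot1 for the singleton case. *)
Definition bigodot (I : finType) (T : Type) (C : {set I})
    (D : I -> set (set T)) : set (set T) :=
  \big[@odot T/[set setT]]_(i in C) D i.

Lemma bigodot1 (I : finType) (T : Type) (i : I) (D : I -> set (set T)) :
  ~ D i set0 -> bigodot [set i]%SET D = D i.
Proof.
move=> D0; rewrite -[RHS](odotT D0); apply: big_pred1_id => j.
exact: finset.in_set1.
Qed.

Record scf_model (AG : finType) (AP : countType) := SCFModel {
  ST : Type;
  ST_nonempty : inhabited ST;
  suc : ST -> set ST;
  nei_agent : AG -> ST -> set (set ST);
  label : ST -> set AP;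
  nei_agent_cover : forall a s, \bigcup_(Y in nei_agent a s) Y = suc s;
  nei_agent_nonempty : forall a s, ~ nei_agent a s set0
}.

Definition nei (AG : finType) (AP : countType) (N : scf_model AG AP)
    (C : {set AG}) (s : ST N) : set (set (ST N)) :=
  if `[< suc s = set0 >] then set0
  else if C == finset.set0 then [set suc s]
  else bigodot C (fun a => nei_agent a s).

(* Main.v *)
(** Pointwise intersections of partitions of [A1] and [A2] form a partition of
    [A1 `&` A2], and [[set setT]], the value of the empty [bigodot], is a
    partition of the whole (nonempty) space, so [bigodot] sends partitions of
    the sets [A i] to a partition of their intersection. *)
Require Import Defs.
From mathcomp Require Import all_boot.
From mathcomp Require Import boolp classical_sets.

Local Open Scope classical_set_scope.

Lemma partition_set0 (T : Type) :
  classical_sets.partition (@set0 (set T)) id set0.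
Proof. by split=> //; rewrite coverE bigcup_set0. Qed.

Lemma partition_set1 (T : Type) (A : set T) :
  A !=set0 -> classical_sets.partition [set A] id A.
Proof.
by move=> A0; split=> [||_ ->//]; [rewrite coverE bigcup_set1|exact: trivIset1].
Qed.

(** Members of [odot] are nonempty by definition. A point shared by [Y1]&[Y2] and [Z1]&[Z2] lies in
    all four sets, so disjointness within [D1] and within [D2] forces [Y1 = Z1] and [Y2 = Z2]. *)
Lemma partition_odot (T : Type) (D1 D2 : set (set T)) (A1 A2 : set T) :
  classical_sets.partition D1 id A1 -> classical_sets.partition D2 id A2 ->
  classical_sets.partition (odot D1 D2) id (A1 `&` A2).
Proof.
move=> [<- t1 _] [<- t2 _]; split; last by move=> ? [? [? []]].
- apply/seteqP; split=> [x [_ [Y1 [Y2 [DY1 DY2 -> _]]] [Y1x Y2x]]|].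
    by split; [exists Y1|exists Y2].
  move=> x [[Y1 DY1 Y1x] [Y2 DY2 Y2x]]; exists (Y1 `&` Y2) => //.
  by exists Y1, Y2; split=> //; exists x.
- move=> _ _ [Y1 [Y2 [DY1 DY2 -> _]]] [Z1 [Z2 [DZ1 DZ2 -> _]]].
  move=> [x [[Y1x Y2x] [Z1x Z2x]]].
  by congr (_ `&` _); [apply: t1|apply: t2] => //; exists x.
Qed.

Lemma partition_bigodot (I : finType) (T : Type) (C : {set I})
    (D : I -> set (set T)) (A : I -> set T) :
  inhabited T -> (forall i, i \in C -> classical_sets.partition (D i) id (A i)) ->
  classical_sets.partition (bigodot C D) id (\big[setI/setT]_(i in C) A i).
Proof.
move=> [x] DA; apply: (big_rec2 (fun E B => classical_sets.partition E id B)).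
  by apply: partition_set1; exists x.
by move=> i E B /DA; exact: partition_odot.
Qed.

(** Nonemptiness of [C] matters: the empty intersection is [setT]. *)
Lemma bigsetI_const (I : finType) (T : Type) (C : {set I}) (A : set T) :
  C != finset.set0 -> \big[setI/setT]_(i in C) A = A.
Proof.
case/set0Pn=> c cC; rewrite (bigD1 c cC) /=; apply: setIidl.
(* The factors other than the one at [c] intersect to a superset of [A], by induction from
   [setT]. *)
by elim/big_rec: _ => // i B _ AB x Ax; split=> //; exact: AB.
Qed.

Theorem theorem5p6 (AG : finType) (AG_nonempty : (0 < #|AG|)%N)
    (AP : countType) (N : scf_model AG AP) :
  (forall (a : AG) (s : ST N),
     classical_sets.partition (nei [set a]%SET s) id (suc s))
  <->
  (forall (C : {set AG}) (s : ST N),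
     classical_sets.partition (nei C s) id (suc s)).
Proof.
split=> [nei1 C s|neiC a s]; last exact: neiC.
rewrite /nei; case: asboolP => [->|/eqP/set0P s0]; first exact: partition_set0.
have [_|C0] := eqVneq C finset.set0; first exact: partition_set1.
(* All agents of [C] partition the same set, so [suc s] is rewritten as an intersection of copies of
   itself, one per agent. *)
rewrite -(bigsetI_const _ _ C (suc s) C0).
apply: partition_bigodot => [|a _]; first exact: ST_nonempty.
(* Since [suc s] is nonempty, [nei [set a] s] is a one-factor [bigodot], which reduces to
   [nei_agent a s]. *)
have := nei1 a s; rewrite /nei; case: asboolP => [s0'|_].
  by case: s0 => x; rewrite s0'.
rewrite ifF ?bigodot1 //; first exact: nei_agent_nonempty.
by apply/negbTE/set0Pn; exists a; rewrite finset.in_set1.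
Qed.
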